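(* Let $n\in\mathbb{N}$, let $E_0,\dots,E_{n-1}$ be pairwise disjoint sets with $E=\bigcup_{i<n}E_i$, let $U_i$ be a uniform matroid on $E_i$ for each $i<n$, let $N=\bigoplus_{i<n}U_i$, and let $M$ be a matroid on $E$. Assume that there is no nonempty set $W\subseteq E$ which is a union of some of the sets $E_i$ such that the restriction $M\upharpoonright W$ has a base that is independent in $N$. Then for every $J\in\mathcal{I}_M\cap\mathcal{I}_N$ there exists a base $B$ of $N$ that is independent in $M$ and satisfies $J\subseteq\mathsf{span}_M(B)$.
   Context: Matroids are possibly infinite (B-)matroids: a matroid on $E$ is a pair $(E,\mathcal{I})$ with $\mathcal{I}\subseteq\mathcal{P}(E)$ such that (i) $\varnothing\in\mathcal{I}$; (ii) $\mathcal{I}$ is closed under subsets; (iii) for all $I,J\in\mathcal{I}$ with $J$ $\subseteq$-maximal in $\mathcal{I}$ and $I$ not maximal, there is $e\in J\setminus I$ with $I\cup\{e\}\in\mathcal{I}$; (iv) for every $X\subseteq E$, every $I\in\mathcal{I}$ with $I\subseteq X$ extends to a $\subseteq$-maximal element of $\{J\in\mathcal{I}:J\subseteq X\}$. Maximal independent sets are bases; $\mathcal{I}_M$ denotes the set of independent sets of $M$. The restriction $M\upharpoonright W$ is the matroid on $W$ whose independent sets are the $M$-independent subsets of $W$. For $X\subseteq E$, $\mathsf{span}_M(X)$ consists of $X$ together with all $e\in E\setminus X$ such that $B_X\cup\{e\}$ is dependent in $M$, where $B_X$ is a maximal $M$-independent subset of $X$. A matroid $(E,\mathcal{I})$ is uniform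 if for every $I\in\mathcal{I}$, $e\in I$ and $f\in E\setminus I$ we have $(I\setminus\{e\})\cup\{f\}\in\mathcal{I}$. The direct sum $\bigoplus_i U_i$ is the matroid on $\bigcup_i E_i$ in which $I$ is independent iff $I\cap E_i$ is independent in $U_i$ for all $i$. *)

(* Defs.v *)
From mathcomp Require Import all_boot.
From mathcomp Require Import boolp classical_sets.

Set Implicit Arguments.
Unset Strict Implicit.
Unset Printing Implicit Defensive.

Local Open Scope classical_set_scope.

Definition maximal_in (T : Type) (A : set (set T)) (B : set T) : Prop :=
  A B /\ forall C, A C -> B `<=` C -> C `<=` B.

(* Possibly infinite matroids on a ground set E inside an ambient type T. *)
Record matroid (T : Type) (E : set T) := Matroid {
  indep : set (set T);
  indep_ground : forall I, indep I -> I `<=` E;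
  indep_set0 : indep set0;
  indep_subset : forall I J, indep J -> I `<=` J -> indep I;
  indep_augment : forall I J, indep I -> maximal_in indep J ->
    ~ maximal_in indep I ->
    exists e, (J `\` I) e /\ indep (I `|` [set e]);
  indep_extend : forall X I, X `<=` E -> indep I -> I `<=` X ->
    exists J, maximal_in [set K | indep K /\ K `<=` X] J /\ I `<=` J }.

Definition base (T : Type) (E : set T) (M : matroid E) (B : set T) : Prop :=
  maximal_in (indep M) B.

(* By span_indep_choice below, the choice of the maximal independent subset B
   of X is immaterial. *)
Definition span (T : Type) (E : set T) (M : matroid E) (X : set T) : set T :=
  X `|` [set e | (E `\` X) e /\
    exists B, maximal_in [set I | indep M I /\ I `<=` X] B /\
      ~ indep M (B `|` [set e])].

Definition uniform (T : Type) (E : set T) (M : matroid E) : Prop :=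
  forall I e f, indep M I -> I e -> (E `\` I) f ->
    indep M ((I `\ e) `|` [set f]).

Lemma not_maximal_in (T : Type) (A : set (set T)) (B : set T) :
  A B -> ~ maximal_in A B -> exists C x, [/\ A C, B `<=` C, C x & ~ B x].
Proof.
move=> AB nB; apply: contrapT => nC; apply: nB; split=> // C AC BC x Cx.
by apply: contrapT => nBx; apply: nC; exists C, x.
Qed.

Section Restriction.
Variables (T : Type) (E : set T) (M : matroid E) (W : set T).

Definition restr_indep : set (set T) := [set I | indep M I /\ I `<=` W].

Lemma restr_ground I : restr_indep I -> I `<=` W.
Proof. by case. Qed.

Lemma restr_set0 : restr_indep set0.
Proof. by split; [exact: indep_set0|move=> x]. Qed.

Lemma restr_subset I J : restr_indep J -> I `<=` J -> restr_indep I.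
Proof.
move=> [iJ JW] IJ; split; first exact: indep_subset iJ IJ.
by move=> x /IJ /JW.
Qed.

Lemma restr_augment I J : restr_indep I -> maximal_in restr_indep J ->
  ~ maximal_in restr_indep I ->
  exists e, (J `\` I) e /\ restr_indep (I `|` [set e]).
Proof.
move=> rI [[iJ JW] mJ] nI; apply: contrapT => nope.
have aug e : J e -> ~ I e -> ~ indep M (I `|` [set e]).
  move=> Je nIe ie; apply: nope; exists e; split=> //; split=> //.
  by move=> y [/(proj2 rI)//|->]; exact: JW.
have [K [x [[iK KW] IK Kx nIx]]] := not_maximal_in rI nI.
have JD f : W f -> indep M (J `|` [set f]) -> J f.
  move=> Wf iJf; apply: (mJ (J `|` [set f])); last by right.
  - by split=> // y [/JW//|->].
  - by move=> y; left.
have full (L : set T) : indep M L -> L `<=` E by exact: indep_ground.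
have [B [[[iB _] mB] JB]] := @indep_extend _ _ M E J (fun x h => h) iJ (full _ iJ).
have bB : maximal_in (indep M) B.
  by split=> // C iC; apply: mB; split=> //; exact: full.
pose Ix := I `|` [set x].
have iIx : indep M Ix by apply: indep_subset iK _; rewrite /Ix => y [/IK//|->].
have IxW y : Ix y -> W y by rewrite /Ix => -[/(proj2 rI)//|->]; exact: KW.
have [L [[[iL LX] mL] IxL]] : exists L,
    maximal_in [set K | indep M K /\ K `<=` Ix `|` (B `\` W)] L /\ Ix `<=` L.
  apply: indep_extend => // y.
  by case=> [/(full _ iIx)//|[By _]]; exact: full iB _ By.
have bL : maximal_in (indep M) L.
  apply: contrapT => nL.
  have [e [[Be nLe] ie]] := indep_augment iL bB nL.
  have [We|nWe] := pselect (W e).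
    apply: (aug e).
    - apply: JD => //; apply: indep_subset iB _ => y [/JB//|->//].
    - by move=> Ie; apply: nLe; apply: IxL; left.
    - by apply: indep_subset ie _ => y [Iy|->]; [left; apply: IxL; left|right].
  apply: nLe; apply: (mL (L `|` [set e])); last by right.
  - by split=> // y [/LX//|->]; right.
  - by move=> y; left.
pose C := L `\` W.
have CB y : C y -> B y by rewrite /C => -[/LX [/IxW//|[]]].
have iIC : indep M (I `|` C).
  by apply: indep_subset iL _ => y [Iy|[]//]; apply: IxL; left.
have nIC : ~ maximal_in (indep M) (I `|` C).
  move=> [_ /(_ L iL)] h.
  have : (I `|` C) x.
    apply: h; last by apply: IxL; right.
    by move=> y [Iy|[]//]; apply: IxL; left.
  by case=> // -[_]; apply; exact: KW.
have [e [[Be nICe] ie]] := indep_augment iIC bB nIC.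
have nJe : ~ J e.
  move=> Je; apply: (aug e) => //; first by move=> Ie; apply: nICe; left.
  by apply: indep_subset ie _ => y [Iy|->]; [left; left|right].
have nWe : ~ W e.
  move=> We; apply: nJe; apply: JD => //.
  by apply: indep_subset iB _ => y [/JB//|->//].
have iJC : indep M (J `|` C) by apply: indep_subset iB _ => y [/JB//|/CB].
have nJC : ~ maximal_in (indep M) (J `|` C).
  move=> [_ /(_ B iB)] h.
  have : (J `|` C) e by apply: h => // y [/JB//|/CB].
  by case=> // Ce; apply: nICe; right.
have [f [[Lf nJCf] jf]] := indep_augment iJC bL nJC.
have [Wf|nWf] := pselect (W f); last by apply: nJCf; right.
apply: nJCf; left; apply: JD => //.
by apply: indep_subset jf _ => y [Jy|->]; [left; left|right].
Qed.

Lemma restr_extend X I : X `<=` W -> restr_indep I -> I `<=` X ->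
  exists J, maximal_in [set K | restr_indep K /\ K `<=` X] J /\ I `<=` J.
Proof.
move=> XW [iI IW] IX.
have [|||J [[[iJ JX] mJ] IJ]] := @indep_extend _ _ M (X `&` E) I.
- by move=> y [].
- exact: iI.
- by move=> y Iy; split; [exact: IX|exact: indep_ground iI _ Iy].
exists J; split=> //; split.
  by split; [split=> // y /JX [/XW]|move=> y /JX []].
move=> C [[iC CW] CX]; apply: mJ; split=> // y Cy; split; first exact: CX.
exact: indep_ground iC _ Cy.
Qed.

Definition restrict : matroid W := Matroid restr_ground restr_set0
  restr_subset restr_augment restr_extend.

End Restriction.

Section DirectSum.
Variables (T K : Type) (F : K -> set T).
Hypothesis (dF : trivIset [set: K] F).
Variable U : forall i, matroid (F i).
Let E := \bigcup_i F i.

Definition dsum_indep : set (set T) :=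
  [set I | I `<=` E /\ forall i, indep (U i) (I `&` F i)].

Let same i j x : F i x -> F j x -> i = j.
Proof. by move=> Fi Fj; apply: (dF (i := i) (j := j)) => //; exists x. Qed.

Lemma dsum_ground I : dsum_indep I -> I `<=` E.
Proof. by case. Qed.

Lemma dsum_set0 : dsum_indep set0.
Proof. by split=> [x//|i]; rewrite set0I; exact: indep_set0. Qed.

Lemma dsum_subset I J : dsum_indep J -> I `<=` J -> dsum_indep I.
Proof.
move=> [JE iJ] IJ; split=> [x /IJ /JE//|i].
by apply: indep_subset (iJ i) _; exact: setSI.
Qed.

Let glue I i L : dsum_indep I -> indep (U i) L ->
  dsum_indep ((I `\` F i) `|` L).
Proof.
move=> [IE iI] iL; have LF := indep_ground iL; split=> [x|j].
  by move=> [[/IE//]|/LF Fx]; exists i.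
have [eij|nij] := pselect (i = j).
  by subst j; apply: indep_subset iL _ => x [[[_ nF] Fx|//]].
apply: indep_subset (iI j) _ => x [[[Ix _] Fx//|/LF Fix Fjx]].
by case: nij; exact: same Fix Fjx.
Qed.

Let maxI I i : maximal_in dsum_indep I ->
  maximal_in (indep (U i)) (I `&` F i).
Proof.
move=> [dI mI]; split; first exact: (proj2 dI).
move=> L iL IL x Lx; split; last exact: indep_ground iL _ Lx.
apply: (mI _ (glue dI iL)); last by right.
move=> y Iy; have [Fy|nFy] := pselect (F i y); last by left.
by right; apply: IL.
Qed.

Lemma dsum_augment I J : dsum_indep I -> maximal_in dsum_indep J ->
  ~ maximal_in dsum_indep I ->
  exists e, (J `\` I) e /\ dsum_indep (I `|` [set e]).
Proof.
move=> dI mJ nI.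
have [L [x [[LE iL] IL Lx nIx]]] := not_maximal_in dI nI.
have [i _ Fix] := LE _ Lx.
have nIi : ~ maximal_in (indep (U i)) (I `&` F i).
  move=> [_ /(_ _ (iL i) (setSI IL))] h.
  by have [] : (I `&` F i) x by exact: h.
have [e [[[Je Fe] nIe] ie]] := indep_augment (proj2 dI i) (maxI i mJ) nIi.
exists e; split; first by split=> // Ie; apply: nIe.
apply: dsum_subset (glue dI ie) _ => y [Iy|->]; last by right; right.
by have [Fy|nFy] := pselect (F i y); [right; left|left].
Qed.

Lemma dsum_extend X I : X `<=` E -> dsum_indep I -> I `<=` X ->
  exists J, maximal_in [set L | dsum_indep L /\ L `<=` X] J /\ I `<=` J.
Proof.
move=> XE [IE iI] IX.
have /choice [J HJ] i : exists J, maximal_in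
    [set L | indep (U i) L /\ L `<=` X `&` F i] J /\ I `&` F i `<=` J.
  by apply: indep_extend; [exact: subIsetr|exact: iI|exact: setSI].
have JF i x : J i x -> X x /\ F i x by have [[[_ h] _] _] := HJ i; exact: h.
pose B := \bigcup_i J i.
have BF i : B `&` F i = J i.
  apply/seteqP; split=> x; last by move=> Jx; split; [exists i|case: (JF i x)].
  by move=> [[j _ Jx] Fx]; have [_ Fjx] := JF _ _ Jx; rewrite (same Fx Fjx).
have BX : B `<=` X by move=> x [i _ /JF []].
exists B; split; last first.
  move=> x Ix; have [i _ Fx] := IE _ Ix; exists i => //.
  by have [_] := HJ i; apply.
split.
  by split=> //; split=> [x /BX /XE//|i]; rewrite BF; have [[[]]] := HJ i.
move=> C [[CE iC] CX] BC x Cx; have [i _ Fx] := CE _ Cx.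
exists i => //; have [[_ mJ] _] := HJ i; apply: (mJ (C `&` F i)) => //.
  by split; [exact: iC|exact: setSI].
by rewrite -BF; exact: setSI.
Qed.

Definition direct_sum : matroid (\bigcup_i F i) := Matroid dsum_ground dsum_set0
  dsum_subset dsum_augment dsum_extend.

End DirectSum.

Lemma span_indep_choice (T : Type) (E : set T) (M : matroid E)
    (X B C : set T) (e : T) :
  maximal_in [set I | indep M I /\ I `<=` X] B ->
  maximal_in [set I | indep M I /\ I `<=` X] C ->
  ~ X e -> ~ indep M (B `|` [set e]) -> ~ indep M (C `|` [set e]).
Proof.
move=> [[iB BX] mB] [[iC CX] mC] nXe nBe iCe.
pose R := restrict M (X `|` [set e]).
have rC : indep R C by split=> // y /CX; left.
have bB : maximal_in (indep R) B.
  split; first by split=> // y /BX; left.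
  move=> D [iD DX] BD; apply: mB => //; split=> // y Dy.
  case: (DX y Dy) => // ye; case: nBe; apply: indep_subset iD _ => z [/BD//|->].
  by rewrite -ye.
have nC : ~ maximal_in (indep R) C.
  move=> [_ /(_ (C `|` [set e]))] h; apply: nXe; apply: (CX); apply: h.
  - by split=> // y [/CX|]; [left|right].
  - by move=> y; left.
  - by right.
have [f [[Bf nCf] [iCf _]]] := indep_augment rC bB nC.
apply: nCf; apply: (mC (C `|` [set f])); last by right.
- by split=> // y [/CX//|->]; exact: BX.
- by move=> y; left.
Qed.

(* Main.v *)
(** By uniformity, a common independent set J can be enlarged class by class
    until each class E_i is either full (J meets E_i in a base of U_i) or spanned
    by J in M.  The spanned classes cannot be all of them, since otherwise J would
    be a base of M; so by induction on the number of classes the union Z of the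
    spanned classes contains an M-independent base of N restricted to Z which
    spans the part of J inside Z.  Completing it by elements of J outside Z yields
    a common independent set K spanning J.  After enlarging K again, a class which
    is not full is spanned and was not spanned by J.  Hence the number of spanned
    classes grows strictly until every class is full. *)
Require Import Defs.
From mathcomp Require Import all_boot.
From mathcomp Require Import boolp classical_sets.

Local Open Scope classical_set_scope.

Set Implicit Arguments.
Unset Strict Implicit.
Unset Printing Implicit Defensive.

(** * Spanning by independent sets of one matroid *)

Section Spanning.
Variables (T : Type) (E : set T) (M : matroid E).
Implicit Types A B I X : set T.

(* For independent B this says that A meets E inside the span of B; points
   outside the ground set satisfy it trivially. *)
Definition spans B A : Prop := forall x, A x -> indep M (B `|` [set x]) -> B x.

Lemma spans_mono I B A : I `<=` B -> spans I A -> spans B A.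
Proof.
move=> IB sI x Ax iBx; apply/IB/sI => //.
by apply: indep_subset iBx _; exact: setSU.
Qed.

Lemma spans_maximal X B : maximal_in [set I | indep M I /\ I `<=` X] B ->
  spans B X.
Proof.
move=> [[_ BX] mB] x Xx iBx; apply: (mB (B `|` [set x])); last by right.
- by split=> // y [/BX|->].
- exact: subsetUl.
Qed.

Lemma maximal_spans X B : indep M B -> B `<=` X -> spans B X ->
  maximal_in [set I | indep M I /\ I `<=` X] B.
Proof.
move=> iB BX sB; split=> // C [iC CX] BC x Cx; apply: sB; first exact: CX.
by apply: indep_subset iC _ => y [/BC|->].
Qed.

(** [B] is maximal in the union of [I] and [B], and so is some [L] containing [I]. For [x] outside
    this union, as the span does not depend on the chosen maximal set, independence of [B + x] gives
    that of [L + x], hence of [I + x]. *)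
Lemma spans_trans I B A : indep M I -> indep M B -> spans B I -> spans I A ->
  spans B A.
Proof.
move=> iI iB sBI sIA x Ax iBx.
have [[Ix|//]|nIBx] := pselect ((I `|` B) x); first exact: sBI.
have mB : maximal_in [set K | indep M K /\ K `<=` I `|` B] B.
  by apply: maximal_spans => // y [Iy|//]; exact: sBI.
have [||L [mL IL]] := @indep_extend _ _ M (I `|` B) I _ iI.
- by move=> y [/(indep_ground iI)|/(indep_ground iB)].
- exact: subsetUl.
case: (span_indep_choice mL mB nIBx _ iBx) => iLx.
apply: nIBx; left; apply: sIA => //.
by apply: indep_subset iLx _; exact: setSU.
Qed.

Lemma base_restrict_spans B X : indep M B -> B `<=` X -> spans B X ->
  base (restrict M X) B.
Proof. exact: maximal_spans. Qed.

Lemma spans_subset_span B A : A `<=` E -> indep M B -> spans B A ->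
  A `<=` span M B.
Proof.
move=> AE iB sB x Ax; have [Bx|nBx] := pselect (B x); [by left|right].
split; first by split=> //; exact: AE.
exists B; split; last by move=> /(sB _ Ax).
by apply: maximal_spans => // y.
Qed.

End Spanning.

(** Were [I] not a base, some [I + x] would be independent, and uniformity would trade [x] for
    [e]. *)
Lemma uniform_base_of_dependent (T : Type) (E : set T) (U : matroid E)
    (I : set T) (e : T) :
  uniform U -> indep U I -> E e -> ~ indep U (I `|` [set e]) -> base U I.
Proof.
move=> unifU iI Ee dIe; apply: contrapT => nI.
have [C [x [iC IC Cx nIx]]] := not_maximal_in iI nI.
have iIx : indep U (I `|` [set x]) by apply: indep_subset iC _ => y [/IC|->].
apply: dIe; have [Ixe|nIxe] := pselect ((I `|` [set x]) e).
  by apply: indep_subset iIx _ => y [Iy|->//]; left.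
apply: indep_subset (unifU _ x e iIx _ _) _; [by right|by []|].
move=> y [Iy|->]; [left|by right].
by split; [left|move=> yx; apply: nIx; rewrite -yx].
Qed.

(** * Common independent sets of [M] and a direct sum of uniform matroids *)

Section DirectSumOfUniform.
Variables (T : Type) (n : nat) (F : 'I_n -> set T).
Hypothesis disjF : trivIset [set: 'I_n] F.
Variable U : forall i : 'I_n, matroid (F i).
Hypothesis unifU : forall i : 'I_n, uniform (U i).
Variable M : matroid (\bigcup_(i : 'I_n) F i).
Implicit Types (I J K B : set T) (S : pred 'I_n) (i j : 'I_n).

Local Notation N := (direct_sum disjF U).

Definition common J : Prop := indep M J /\ indep N J.

Definition full J i : Prop := base (U i) (J `&` F i).

Definition classes S : set T := \bigcup_(i in [set i | S i]) F i.

Lemma same_class i j x : F i x -> F j x -> i = j.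
Proof. by move=> Fi Fj; apply: (disjF (i := i) (j := j)) => //; exists x. Qed.

Lemma fullS J K i : J `<=` K -> indep N K -> full J i -> full K i.
Proof.
move=> JK [_ iK] [_ mJ]; split; first exact: iK.
move=> C iC KC; apply: subset_trans (mJ C iC _) _; last exact: setSI.
by apply: subset_trans KC; exact: setSI.
Qed.

Lemma full_base J : indep N J -> (forall i, full J i) -> base N J.
Proof.
move=> iJ fJ; split=> // C [CE iC] JC x Cx; have [i _ Fx] := CE _ Cx.
have [_ mJ] := fJ i.
by have [] : (J `&` F i) x by apply: (mJ (C `&` F i)) => //; exact: setSI.
Qed.

Definition saturated J i : Prop := full J i \/ spans M J (F i).

Lemma saturatedS J K i : J `<=` K -> indep N K -> saturated J i ->
  saturated K i.
Proof.
move=> JK iK [fJ|sJ]; [left; exact: fullS fJ|right; exact: spans_mono sJ].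
Qed.

(* A maximal U_i-independent subset of a base of M restricted to the union of J
   and E_i either is a base of U_i or exhausts the part of that base in E_i. *)
Lemma saturate_class J i : common J ->
  exists K, [/\ common K, J `<=` K, K `<=` J `|` F i & saturated K i].
Proof.
move=> [iJ [JE nJ]].
have [||X [mX JX]] := @indep_extend _ _ M (J `|` F i) J _ iJ.
- by move=> x [/JE//|Fx]; exists i.
- exact: subsetUl.
have [[iX XJ] _] := mX.
have [||L [mL JL]] := @indep_extend _ _ (U i) (X `&` F i) _ _ (nJ i).
- exact: subIsetr.
- exact: setSI.
have [[iL LX] _] := mL.
have KX : J `|` L `<=` X by move=> x [/JX|/LX []].
have KL : (J `|` L) `&` F i = L.
  apply/seteqP; split=> [x [[Jx Fx|//]]|x Lx]; first exact: JL.
  by split; [right|case: (LX _ Lx)].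
exists (J `|` L); split.
- split; first exact: indep_subset iX KX.
  split=> [x /KX /(indep_ground iX)//|j].
  have [<-|nij] := pselect (i = j); first by rewrite KL.
  apply: indep_subset (nJ j) _ => x [[//|/LX [_ Fix] Fjx]].
  by case: nij; exact: same_class Fix Fjx.
- exact: subsetUl.
- by move=> x [Jx|/LX []]; [left|right].
(* If [L] exhausts [X] in [F i], the new set is all of [X] and spans [F i]; otherwise a leftover
   element witnesses, by uniformity, that [L] is a base of [U i]. *)
have [XL|nXL] := pselect (X `&` F i `<=` L).
  right=> x Fx iKx; suff <- : X = J `|` L.
    apply: (spans_maximal mX); first by right.
    apply: indep_subset iKx _ => y [Xy|->]; last by right.
    by left; case: (XJ _ Xy) => [|Fy]; [left|right; exact: XL].
  apply/seteqP; split=> // y Xy.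
  by case: (XJ _ Xy) => [|Fy]; [left|right; exact: XL].
left; rewrite /full KL.
have [e [[Xe Fe] nLe]] : exists e, (X `&` F i) e /\ ~ L e.
  by move/existsNP: nXL => [e /not_implyP]; exists e.
apply: (uniform_base_of_dependent (@unifU i) iL Fe).
by move/(spans_maximal mL) => h; exact/nLe/h.
Qed.

Lemma saturate S J : common J -> J `<=` classes S ->
  exists K, [/\ common K, J `<=` K, K `<=` classes S &
    forall i, S i -> saturated K i].
Proof.
move=> cJ JS.
have [K [cK JK KS sK]] : exists K, [/\ common K, J `<=` K, K `<=` classes S &
    forall i, i \in enum S -> saturated K i].
  have : {subset enum S <= S} by move=> i; rewrite mem_enum.
  elim: (enum S) => [|i s IHs] sS; first by exists J; split.
  have [|K [cK JK KS sK]] := IHs.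
    by move=> j js; apply: sS; rewrite inE js orbT.
  have [L [cL KL LK sL]] := saturate_class i cK.
  exists L; split=> //; first exact: subset_trans KL.
    move=> x /LK [/KS//|Fx]; exists i => //; apply: sS; exact: mem_head.
  move=> j; rewrite inE => /orP [/eqP ->//|/sK]; apply: saturatedS => //.
  exact: (proj2 cL).
by exists K; split=> // i Si; apply: sK; rewrite mem_enum.
Qed.

(** Quantifying over all [S] lets the induction pass to fewer classes while keeping the same [M]. *)
Hypothesis no_common_base : forall S J, common J -> J `<=` classes S ->
  spans M J (classes S) -> ~ (classes S !=set0).

Let spanned S J : pred 'I_n := [pred i | S i && `[< spans M J (F i) >]].

Lemma spannedP S J i : reflect (S i /\ spans M J (F i)) (spanned S J i).
Proof.
by apply: (iffP andP) => -[Si] h; split=> //; exact/asboolP.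
Qed.

Lemma spanned_trans S J K : indep M J -> indep M K -> spans M K J ->
  {subset spanned S J <= spanned S K}.
Proof.
move=> iJ iK sKJ i /spannedP [Si sJ]; apply/spannedP; split=> //.
exact: spans_trans sJ.
Qed.

Lemma spanned_proper S J : common J -> J `<=` classes S ->
  classes S !=set0 -> (#|spanned S J| < #|S|)%N.
Proof.
move=> cJ JS S0; apply: proper_card; apply/properP; split.
  by apply/fintype.subsetP => i /andP [].
apply: contrapT => nS; apply: (no_common_base cJ JS _ S0) => x [i /= Si Fx].
apply: contrapT => nx; apply: nS; exists i => //.
by apply/spannedP => -[_ sJ]; apply: nx; exact: sJ.
Qed.

(* Replaces J inside the spanned classes by B, where B comes from the induction
   hypothesis for those classes. *)
Lemma exchange_spanned S J B : common J -> J `<=` classes S -> common B ->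
  B `<=` classes (spanned S J) -> spans M B (J `&` classes (spanned S J)) ->
  exists K, [/\ common K, K `<=` classes S, B `<=` K & spans M K J].
Proof.
set Z := classes (spanned S J) => -[iJ [JE nJ]] JS [iB [BE nB]] BZ sB.
have [||K [mK BK]] := @indep_extend _ _ M (B `|` (J `\` Z)) B _ iB.
- by move=> x [/BE//|[/JE]].
- exact: subsetUl.
have [[iK KX] _] := mK; exists K; split=> //.
(* Inside a spanned class [K] is contained in [B], inside any other class in [J]. *)
- split=> //; split=> [x /(indep_ground iK)//|i].
  have [iS|niS] := boolP (spanned S J i).
    apply: indep_subset (nB i) _ => x [/KX [//|[_ nZx]] Fx].
    by case: nZx; exists i.
  apply: indep_subset (nJ i) _ => x [/KX [/BZ [j /= jS Fjx]|[]//] Fx].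
  by move: niS; rewrite (same_class Fx Fjx) jS.
- move=> x /KX [/BZ [i /andP [Si _] Fx]|[/JS//]].
  by exists i.
- move=> x Jx; have [Zx|nZx] := pselect (Z x).
    by apply: (spans_mono BK sB).
  by apply: (spans_maximal mK); right.
Qed.

(** The outer induction is on the number of classes in [S], the inner one on the number of those not
    spanned by [J]. *)
Lemma full_spanning S J : common J -> J `<=` classes S ->
  exists B, [/\ common B, B `<=` classes S, forall i, S i -> full B i &
    spans M B J].
Proof.
have [m] := ubnP #|S|; elim: m S J => // m IHm S J /ltnSE leS.
have [k] := ubnP (#|S| - #|spanned S J|)%N; elim: k J => // k IHk J /ltnSE lek.
move=> cJ JS.
have [S0|S0] := pselect (classes S !=set0); last first.
  (* All classes in [S] are empty here, so fullness is trivial. *)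
  exists J; split=> // i Si; split; first exact: (proj2 (proj2 cJ)).
  move=> C iC _ x Cx; case: S0; exists x; exists i => //.
  exact: indep_ground iC _ Cx.
have [J1 [cJ1 JJ1 J1S sat1]] := saturate cJ JS.
have [|||B [cB BZ fB sB]] := IHm (spanned S J1) (J1 `&` classes (spanned S J1)).
- exact: leq_trans (spanned_proper cJ1 J1S S0) leS.
- case: cJ1 => iJ1 nJ1.
  by split; [apply: indep_subset iJ1 _|apply: indep_subset nJ1 _];
    exact: subIsetl.
- exact: subIsetr.
have [K [cK KS BK sKJ1]] := exchange_spanned cJ1 J1S cB BZ sB.
have [J2 [cJ2 KJ2 J2S sat2]] := saturate cK KS.
have sJ2J1 : spans M J2 J1 by exact: spans_mono sKJ1.
have sJ2J : spans M J2 J by move=> x /JJ1; exact: sJ2J1.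
have [fJ2|] := pselect (forall i, S i -> full J2 i); first by exists J2.
move=> /existsNP [i /not_implyP [Si nfi]].
have si : spans M J2 (F i) by case: (sat2 i Si).
have [|B2 [cB2 B2S fB2 sB2]] := IHk J2 _ cJ2 J2S; last first.
  exists B2; split=> //; apply: spans_trans sJ2J => //.
  - by case: cJ2.
  - by case: cB2.
apply: leq_trans lek; apply: ltn_sub2l.
  exact: spanned_proper.
apply: proper_card; apply/properP; split.
  by apply/fintype.subsetP; apply: spanned_trans => //; [case: cJ|case: cJ2].
(* If [J] spanned class [i], so would [J1]; then [B], and with it [J2], would be full there. *)
exists i; first exact/spannedP.
apply/spannedP => -[_ sJi]; apply: nfi.
apply: (fullS (subset_trans BK KJ2) (proj2 cJ2)); apply: fB.
by apply/spannedP; split=> //; exact: spans_mono sJi.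
Qed.

End DirectSumOfUniform.

Theorem theorem3p6 (T : Type) (n : nat) (F : 'I_n -> set T)
    (disjF : trivIset [set: 'I_n] F)
    (U : forall i : 'I_n, matroid (F i))
    (unifU : forall i : 'I_n, uniform (U i))
    (M : matroid (\bigcup_(i : 'I_n) F i))
    (noW : ~ exists W : set T,
      [/\ W !=set0,
          exists S : set 'I_n, W = \bigcup_(i in S) F i
        & exists B : set T,
            base (restrict M W) B /\ indep (direct_sum disjF U) B])
    (J : set T) (JM : indep M J) (JN : indep (direct_sum disjF U) J) :
  exists B : set T,
    [/\ base (direct_sum disjF U) B, indep M B & J `<=` span M B].
Proof.
have no_common_base (S : pred 'I_n) I : common disjF U M I ->
    I `<=` classes F S -> spans M I (classes F S) -> ~ (classes F S !=set0).
  move=> [iI nI] IS sI S0; apply: noW; exists (classes F S); split=> //.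
  - by exists [set i | S i].
  - by exists I; split=> //; exact: base_restrict_spans.
have JE := indep_ground JM.
have [||B [[iB nB] _ fB sB]] :=
    full_spanning unifU no_common_base (S := predT) (J := J).
- by [].
- by move=> x /JE [i _ Fx]; exists i.
exists B; split=> //; last exact: spans_subset_span.
by apply: full_base => // i; exact: fB.
Qed.
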